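(* Let $\alpha\in\mathbb{C}_2\setminus\{0\}$ satisfy $|\alpha|\le\frac14$. Then $T(2)\cap T(\alpha)\subset\{\alpha\}$. Moreover, if $|\alpha|<\frac14$, then $T(2)\cap T(\alpha)=\emptyset$.
   Context: $\mathbb{C}_2$ is the completion of $\overline{\mathbb{Q}_2}$, with $2$-adic absolute value $|\cdot|$, $|2|=\frac12$. For $\lambda\in\mathbb{C}_2\setminus\{0,1\}$, $f_\lambda(z)=\frac{(z^2-\lambda)^2}{4z(z-1)(z-\lambda)}$ is the Lattès map induced by multiplication by $2$ on the Legendre curve $E_\lambda:y^2=x(x-1)(x-\lambda)$. For $\alpha\in\mathbb{C}_2$, $T(\alpha)=\{\lambda\in\mathbb{C}_2\setminus\{0,1\}:\alpha\text{ is preperiodic for }f_\lambda\}$. *)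

(* Defs.v *)
From HB Require Import structures.
From mathcomp Require Import all_boot all_order all_algebra.
From mathcomp Require Import classical_sets reals.

Set Implicit Arguments.
Unset Strict Implicit.
Unset Printing Implicit Defensive.

Import Order.TTheory GRing.Theory Num.Theory.
Local Open Scope classical_set_scope.
Local Open Scope ring_scope.

Section ValuedFields.
Variable R : realType.

Record nonarch_absval (K : fieldType) (v : K -> R) : Prop := NonarchAbsval {
  absv_ge0 : forall x, 0 <= v x;
  absv_eq0 : forall x, v x = 0 <-> x = 0;
  absvM : forall x y, v (x * y) = v x * v y;
  absv_ultra : forall x y, v (x + y) <= Num.max (v x) (v y) }.

Definition absv_cauchy (K : fieldType) (v : K -> R) (u : nat -> K) : Prop :=
  forall e : R, 0 < e -> exists N : nat, forall m n : nat,
    (N <= m)%N -> (N <= n)%N -> v (u m - u n) < e.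

Definition absv_cvg (K : fieldType) (v : K -> R) (u : nat -> K) (l : K) : Prop :=
  forall e : R, 0 < e -> exists N : nat, forall n : nat,
    (N <= n)%N -> v (u n - l) < e.

Definition absv_complete (K : fieldType) (v : K -> R) : Prop :=
  forall u : nat -> K, absv_cauchy v u -> exists l : K, absv_cvg v u l.

Record is_completion (K L : fieldType) (vK : K -> R) (vL : L -> R)
    (i : {rmorphism K -> L}) : Prop := IsCompletion {
  completion_absv : nonarch_absval vL;
  completion_isom : forall x, vL (i x) = vK x;
  completion_dense : forall (y : L) (e : R), 0 < e ->
    exists x : K, vL (y - i x) < e;
  completion_complete : absv_complete vL }.

Record is_algebraic_closure (K L : fieldType) (i : {rmorphism K -> L}) : Prop :=
  IsAlgebraicClosure {
    algclosure_closed : GRing.closed_field_axiom L;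
    algclosure_algebraic : forall y : L, algebraicOver i y }.

Definition padic_abs (p : nat) (x : rat) : R :=
  if x == 0 then 0
  else p%:R ^ ((logn p `|denq x|)%:Z - (logn p `|numq x|)%:Z).

(* C_p is characterized by its construction Q -> Q_p -> Qbar_p -> C_p, which
   determines (C, v) up to isometric isomorphism: the completion of Q is unique,
   so is its algebraic closure, the extension of the absolute value to the
   latter, and the completion of the result. *)
Definition is_Cp (p : nat) (C : fieldType) (v : C -> R) : Prop :=
  exists (Qp Qpbar : fieldType) (vQp : Qp -> R) (vQpbar : Qpbar -> R)
         (i : {rmorphism rat -> Qp}) (j : {rmorphism Qp -> Qpbar})
         (k : {rmorphism Qpbar -> C}),
    [/\ is_completion (padic_abs p) vQp i,
        is_algebraic_closure j,
        nonarch_absval vQpbar /\ (forall x, vQpbar (j x) = vQp x)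
      & is_completion vQpbar v k].

End ValuedFields.

Definition preperiodic (X : Type) (f : X -> X) (x : X) : Prop :=
  exists m n : nat, (m < n)%N /\ iter m f x = iter n f x.

(* The projective line P^1(C) is [option C], with [None] the point at infinity.
   For lambda distinct from 0 and 1 numerator and denominator have no common
   zero, and the numerator has the larger degree, so the poles and infinity are
   exactly the points mapped to infinity. *)
Definition lattes (C : fieldType) (lambda : C) (P : option C) : option C :=
  if P is Some z then
    let d := 4%:R * z * (z - 1) * (z - lambda) in
    if d == 0 then None else Some ((z ^+ 2 - lambda) ^+ 2 / d)
  else None.

Definition preper_params (C : fieldType) (alpha : C) : set C :=
  [set lambda | [/\ lambda != 0, lambda != 1
                  & preperiodic (lattes lambda) (Some alpha)]].

(* Main.v *)
Require Import Defs.
From mathcomp Require Import all_boot all_order all_algebra.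
From mathcomp Require Import classical_sets reals.
From mathcomp Require Import ring lra.

Import Order.TTheory GRing.Theory Num.Theory.
Local Open Scope classical_set_scope.
Local Open Scope ring_scope.

(** Multiplication by 2 contracts the formal group at 2: if [z] is larger than
    both [1] and [lambda], then [|f z| = |z| / |4| = 4 |z|], so [z] escapes to
    infinity without reaching it. Hence a preperiodic point and all its finite
    iterates are bounded by [max 1 |lambda|]. Applied to [f 2] this forces
    [lambda = 2] or [|lambda| <= 1/4]; applied to [f (f 2)], where
    [f 2 = 1 + lambda^2 / (8 (2 - lambda))] is close to the pole [1] when
    [lambda] is small, it excludes [|lambda| < 1/4]. In the remaining cases
    [lambda = 2] and [|lambda| = 1/4], the point [f alpha] violates the bound
    unless [alpha = lambda]. *)

(** * Elementary properties of nonarchimedean absolute values *)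

Section NonarchAbsval.
Context {R : realType} {K : fieldType} {v : K -> R}.
Hypothesis hv : nonarch_absval v.

Lemma absv0 : v 0 = 0.
Proof. exact/(absv_eq0 hv). Qed.

Lemma absv_neq0 x : (v x != 0) = (x != 0).
Proof. by congr negb; apply/eqP/eqP => /(absv_eq0 hv). Qed.

Lemma absv_gt0 x : (0 < v x) = (x != 0).
Proof. by rewrite lt0r absv_neq0 (absv_ge0 hv) andbT. Qed.

Lemma absv1 : v 1 = 1.
Proof.
have v1_neq0 : v 1 != 0 by rewrite absv_neq0 oner_neq0.
by apply: (mulfI v1_neq0); rewrite -(absvM hv) !mulr1.
Qed.

Lemma absvX x n : v (x ^+ n) = v x ^+ n.
Proof.
by elim: n => [|n IHn]; rewrite ?expr0 ?absv1 // !exprS (absvM hv) IHn.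
Qed.

Lemma absvN x : v (- x) = v x.
Proof.
apply: (@pexpIrn _ 2) => //; rewrite ?nnegrE ?(absv_ge0 hv) //.
by rewrite -!absvX sqrrN.
Qed.

Lemma absv_distC x y : v (x - y) = v (y - x).
Proof. by rewrite -absvN opprB. Qed.

Lemma absvV x : v x^-1 = (v x)^-1.
Proof.
have [->|x_neq0] := eqVneq x 0; first by rewrite invr0 absv0 invr0.
have vx_neq0 : v x != 0 by rewrite absv_neq0.
by apply: (mulfI vx_neq0); rewrite -(absvM hv) !mulfV // absv1.
Qed.

(** Writing [y] as [(x + y) - x] gives [v y <= max (v (x + y)) (v x)], and [v x < v y] rules out the
    second term. *)
Lemma absvD_ltr x y : v x < v y -> v (x + y) = v y.
Proof.
move=> lt_xy; apply: le_anti; apply/andP; split.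
  by apply: le_trans (absv_ultra hv x y) _; rewrite ge_max lexx ltW.
have := absv_ultra hv (x + y) (- x).
by rewrite addrAC subrr add0r absvN le_max [v y <= v x]leNgt lt_xy orbF.
Qed.

Lemma absvB_ltr x y : v x < v y -> v (x - y) = v y.
Proof. by move=> lt_xy; rewrite -[RHS]absvN absvD_ltr ?absvN. Qed.

Lemma absvB_ltl x y : v y < v x -> v (x - y) = v x.
Proof. by move=> lt_yx; rewrite absv_distC absvB_ltr. Qed.

Lemma absvB_le x y (c : R) : v x <= c -> v y <= c -> v (x - y) <= c.
Proof.
move=> xc yc; apply: le_trans (absv_ultra hv x (- y)) _.
by rewrite absvN ge_max xc.
Qed.

End NonarchAbsval.

(** * The absolute value of C_p on the integers *)

Lemma Cp_nonarch (R : realType) p (C : fieldType) (v : C -> R) :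
  is_Cp p v -> nonarch_absval v.
Proof. by move=> [? [? [? [? [? [? [? []]]]]]]] _ _ _ []. Qed.

Lemma Cp_absv_rat (R : realType) p (C : fieldType) (v : C -> R) (n : nat) :
  is_Cp p v -> v n%:R = padic_abs R p n%:R.
Proof.
move=> [Qp [Qpb [vQp [vQpb [i [j [k]]]]]]] [hi _ [_ hj] hk].
have -> : n%:R = k (j (i n%:R)) by rewrite !rmorph_nat.
by rewrite (completion_isom hk) hj (completion_isom hi).
Qed.

Lemma C2_absv2 (R : realType) (C : fieldType) (v : C -> R) :
  is_Cp 2 v -> v 2%:R = 2%:R^-1.
Proof. by move=> hC; rewrite (Cp_absv_rat _ _ _ _ 2 hC). Qed.

Lemma preperiodic_next (X : Type) (f : X -> X) x :
  preperiodic f x -> preperiodic f (f x).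
Proof.
move=> [m [n [lt_mn eq_mn]]]; exists m, n; split=> //.
by rewrite -!iterSr !iterS eq_mn.
Qed.

Lemma lattes_Some (C : fieldType) (lambda z : C) : 2%:R != 0 :> C ->
  z != 0 -> z != 1 -> z != lambda ->
  lattes lambda (Some z) =
    Some ((z ^+ 2 - lambda) ^+ 2 / (4%:R * z * (z - 1) * (z - lambda))).
Proof.
move=> C2 z0 z1 zl; rewrite /lattes ifF //; apply/negbTE.
have -> : 4%:R = 2%:R * 2%:R :> C by rewrite -natrM.
by rewrite !mulf_neq0 // subr_eq0.
Qed.

(** * Escape to infinity under the Lattès map *)

Section LattesEscape.
Context {R : realType} {C : fieldType} {v : C -> R}.
Hypotheses (hv : nonarch_absval v) (v2 : v 2%:R = 2%:R^-1).

Lemma two_neq0_absv : 2%:R != 0 :> C.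
Proof. by rewrite -(absv_neq0 hv) v2 invr_eq0 pnatr_eq0. Qed.

Lemma absv4 : v 4%:R = 4%:R^-1.
Proof.
have -> : 4%:R = 2%:R * 2%:R :> C by rewrite -natrM.
by rewrite (absvM hv) v2; field.
Qed.

(** No pole has to be excluded: there both sides are 0, because the inverse of 0 is 0. *)
Lemma absv_lattes (lambda z : C) :
  v ((z ^+ 2 - lambda) ^+ 2 / (4%:R * z * (z - 1) * (z - lambda))) =
  4%:R * v (z ^+ 2 - lambda) ^+ 2 / (v z * v (z - 1) * v (z - lambda)).
Proof.
rewrite (absvM hv) (absvV hv) (absvX hv) !(absvM hv) absv4 !invfM invrK.
by ring.
Qed.

Lemma lattes_escape_step (lambda z : C) : 1 < v z -> v lambda < v z ->
  exists2 w, lattes lambda (Some z) = Some w & v w = 4%:R * v z.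
Proof.
move=> z_gt1 z_gtl; have v1 := absv1 hv.
have z0 : z != 0 by rewrite -(absv_gt0 hv) (lt_trans _ z_gt1).
have z1 : z != 1 by apply: contraTneq z_gt1 => ->; rewrite v1 ltxx.
have zl : z != lambda by apply: contraTneq z_gtl => ->; rewrite ltxx.
rewrite lattes_Some ?two_neq0_absv //; eexists; first by [].
(* Each factor is dominated by its power of [z]: the numerator has size |z|^4 and the denominator
   |z|^3 / 4. *)
rewrite absv_lattes (absvB_ltl hv (z ^+ 2)); last first.
  by rewrite (absvX hv) (lt_trans z_gtl) // expr2 ltr_pMr // (lt_trans _ z_gt1).
rewrite !(absvB_ltl hv z) ?v1 // (absvX hv).
have vz0 : v z != 0 by rewrite (absv_neq0 hv).
by field.
Qed.

Lemma lattes_escape (lambda z : C) n : 1 < v z -> v lambda < v z ->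
  exists2 w, iter n (lattes lambda) (Some z) = Some w & v w = 4%:R ^+ n * v z.
Proof.
move=> z_gt1 z_gtl; elim: n => [|n [w wE vw]].
  by exists z => //; rewrite expr0 mul1r.
have le_zw : v z <= v w.
  by rewrite vw ler_peMl ?(absv_ge0 hv) // exprn_ege1 // ler1n.
have [w' w'E vw'] := lattes_escape_step lambda w (lt_le_trans z_gt1 le_zw)
  (lt_le_trans z_gtl le_zw).
by exists w'; rewrite ?iterS ?wE // vw' vw exprS mulrA.
Qed.

Lemma lattes_preperiodic_bounded (lambda z : C) :
  preperiodic (lattes lambda) (Some z) -> v z <= Num.max 1 (v lambda).
Proof.
move=> [m [n [lt_mn]]]; apply: contraPle.
rewrite gt_max => /andP[z_gt1 z_gtl].
have [w -> vw] := lattes_escape lambda z m z_gt1 z_gtl.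
have [w' -> vw'] := lattes_escape lambda z n z_gt1 z_gtl.
move=> [eq_ww']; have := lt_mn.
rewrite -(@ltr_eXn2l R 4%:R) ?ltr1n // -(@ltr_pM2r _ (v z))
  ?(lt_trans _ z_gt1) //.
by rewrite -vw -vw' eq_ww' ltxx.
Qed.

(** This is the boundedness of f z, itself preperiodic, with the denominator cleared. *)
Lemma lattes_preperiodic_le (lambda z : C) :
  z != 0 -> z != 1 -> z != lambda -> preperiodic (lattes lambda) (Some z) ->
  4%:R * v (z ^+ 2 - lambda) ^+ 2 <=
    Num.max 1 (v lambda) * (v z * v (z - 1) * v (z - lambda)).
Proof.
move=> z0 z1 zl prez; have := preperiodic_next _ _ _ prez.
rewrite lattes_Some ?two_neq0_absv // => /lattes_preperiodic_bounded.
by rewrite absv_lattes ler_pdivrMr // !mulr_gt0 // (absv_gt0 hv) ?subr_eq0.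
Qed.

(** * Parameters for which 2 is preperiodic *)

Lemma absv_two_sub1 : v (2%:R - 1) = 1.
Proof. by rewrite (absvB_ltr hv) (absv1 hv) // v2; lra. Qed.

Lemma two_neq1_absv : 2%:R != 1 :> C.
Proof. by rewrite -subr_eq0 -(absv_neq0 hv) absv_two_sub1 oner_neq0. Qed.

Lemma preper_params2_le (lambda : C) :
  preper_params 2%:R lambda -> lambda != 2%:R -> v lambda <= 4%:R^-1.
Proof.
move=> [l0 l1 pre2] l2; rewrite leNgt; apply/negP => l_gt.
have := lattes_preperiodic_le lambda 2%:R two_neq0_absv two_neq1_absv.
rewrite eq_sym => /(_ l2 pre2).
rewrite -natrX (absvB_ltr hv (2 ^ 2)%:R) ?absv4 // absv_two_sub1 v2.
(* As |4 - lambda| = |lambda|, the bound reads 4 |lambda|^2 <= max(1, |lambda|) |2 - lambda| / 2.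
   The last absolute value is 1/2 if |lambda| < 1/2, and at most |lambda| otherwise. *)
have [l_lt|l_ge] := ltP (v lambda) 2%:R^-1.
  rewrite (absvB_ltl hv 2%:R) ?v2 // max_l; last by lra.
  by nra.
have : v (2%:R - lambda) <= v lambda by apply: (absvB_le hv); rewrite ?v2.
by case: (lerP 1 (v lambda)) => ? ? ?; nra.
Qed.

Lemma preper_params2_ge (lambda : C) :
  preper_params 2%:R lambda -> 4%:R^-1 <= v lambda.
Proof.
move=> [l0 l1 pre2]; rewrite leNgt; apply/negP => l_lt.
have v1 := absv1 hv.
have l_gt0 : 0 < v lambda by rewrite (absv_gt0 hv).
have v2l : v (2%:R - lambda) = 2%:R^-1 by rewrite (absvB_ltl hv) v2 //; lra.
have two_neql : 2%:R != lambda.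
  by rewrite -subr_eq0 -(absv_neq0 hv) v2l invr_eq0 pnatr_eq0.
have := preperiodic_next _ _ _ pre2.
rewrite lattes_Some ?two_neq0_absv ?two_neq1_absv //.
set w := (X in Some X) => prew.
(* The factor 16 is the inverse of |8| |2 - lambda| = 1/8 * 1/2. *)
have vw1 : v (w - 1) = 16%:R * v lambda ^+ 2.
  have -> : w - 1 = lambda ^+ 2 / (2%:R * 4%:R * (2%:R - lambda)).
    rewrite /w; field; rewrite subr_eq0 two_neql /=.
    have -> : 8%:R = 2%:R ^+ 3 :> C by rewrite -natrX.
    by rewrite expf_neq0 // two_neq0_absv.
  rewrite (absvM hv) (absvV hv) !(absvM hv) v2l absv4 v2.
  by field.
have w1_lt1 : v (w - 1) < v 1 by rewrite v1 vw1; nra.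
have vw : v w = 1 by rewrite -[w](subrK 1) (absvD_ltr hv).
have vl_lt1 : v lambda < 1 by lra.
have w0 : w != 0 by rewrite -(absv_neq0 hv) vw oner_neq0.
have w1 : w != 1 by rewrite -subr_eq0 -(absv_gt0 hv) vw1; nra.
have wl : w != lambda by apply: contraTneq vl_lt1 => <-; rewrite vw ltxx.
(* Since [w], [w - lambda] and [w ^+ 2 - lambda] all have absolute value 1, the bound becomes 4 <=
   16 |lambda|^2, against |lambda| < 1/4. *)
have := lattes_preperiodic_le lambda w w0 w1 wl prew.
rewrite max_l; last exact: ltW.
rewrite (absvB_ltl hv (w ^+ 2)) ?(absvX hv) ?vw ?expr1n //.
rewrite (absvB_ltl hv w) ?vw // vw1.
by nra.
Qed.

End LattesEscape.

Theorem theorem4p4 (R : realType) (C : fieldType) (v : C -> R)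
    (hC : is_Cp 2 v) (alpha : C) (alpha_neq0 : alpha != 0)
    (alpha_le : v alpha <= 4%:R^-1) :
  preper_params 2%:R `&` preper_params alpha `<=` [set alpha] /\
  (v alpha < 4%:R^-1 -> preper_params 2%:R `&` preper_params alpha = set0).
Proof.
have hv := Cp_nonarch _ _ _ _ hC; have v2 := C2_absv2 _ _ _ hC.
have v1 := absv1 hv.
have sub : preper_params 2%:R `&` preper_params alpha `<=` [set alpha].
  move=> lambda /= [pre2 [l0 l1 prea]]; apply/eqP; apply: contraT => la.
  have l_ge := preper_params2_ge hv v2 lambda pre2.
  have a_gt0 : 0 < v alpha by rewrite (absv_gt0 hv).
  have a_lt1 : v alpha < v 1 by rewrite v1; lra.
  have a1 : alpha != 1 by apply: contraTneq a_lt1 => ->; rewrite ltxx.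
  (* The case [alpha = lambda] must be set apart: [lambda] is a pole, sent to the fixed point at
     infinity, hence preperiodic. *)
  have al : alpha != lambda by rewrite eq_sym.
  have := lattes_preperiodic_le hv v2 lambda alpha alpha_neq0 a1 al prea.
  rewrite (absvB_ltr hv alpha 1) // v1.
  rewrite (absvB_ltr hv (alpha ^+ 2)) ?(absvX hv); last by nra.
  (* The bound is now 4 |lambda|^2 <= max(1, |lambda|) |alpha| |alpha - lambda|. For [lambda = 2] it
     says 1 <= |alpha| / 2; for |lambda| = 1/4 it says 1/4 <= |alpha| |alpha - lambda|, which is at
     most 1/16. *)
  have [l2|l2] := eqVneq lambda 2%:R.
    rewrite (absvB_ltr hv alpha) l2 v2 ?max_l; lra.
  have l_le := preper_params2_le hv v2 lambda pre2 l2.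
  have : v (alpha - lambda) <= 4%:R^-1 by apply: (absvB_le hv).
  have := absv_ge0 hv (alpha - lambda).
  rewrite max_l; last by lra.
  by nra.
split=> // a_lt; apply/seteqP; split=> // lambda [pre2 prea].
have lE : lambda = alpha by apply: sub.
by have := preper_params2_ge hv v2 lambda pre2; rewrite lE leNgt a_lt.
Qed.
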